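(* Let $X$ be a finite digital image, $Y$ a digital image, and let $f,g:X\to Y$ be continuous functions which are strongly homotopic. Then the induced homomorphisms $f_*,g_*:H_q(X)\to H_q(Y)$ are equal for each $q\ge 0$.
   Context: A digital image is a set $X$ together with a symmetric, antireflexive adjacency relation (equivalently, a simple graph). Write $x\leftrightarrow x'$ for ''adjacent'' and $x\mathrel{\underline{\leftrightarrow}} x'$ for ''adjacent or equal''. A function $f:X\to Y$ between digital images is continuous if $x\leftrightarrow x'$ implies $f(x)\mathrel{\underline{\leftrightarrow}} f(x')$. For integers $a\le b$, $[a,b]_{\mathbb Z}=\{a,\dots,b\}$, where $s,t$ are adjacent iff $|s-t|=1$. Strong homotopy: the $\mathrm{NP}_2$ adjacency on $X\times[0,k]_{\mathbb Z}$ makes two distinct points $(x,t),(x',t')$ adjacent iff $x\mathrel{\underline{\leftrightarrow}} x'$ and $t\mathrel{\underline{\leftrightarrow}} t'$. Continuous $f,g:X\to Y$ are strongly homotopic if for some positive integer $k$ there is $H:X\times[0,k]_{\mathbb Z}\to Y$ with $H(x,0)=f(x)$, $H(x,k)=g(x)$ for all $x$, continuous with respect to the $\mathrm{NP}_2$ adjacency on the domain. Digital homology (the simplicial homology of the clique complex): a $q$-simplex of $X$ is a set of $q+1$ mutually adjacent points, written $\langle x_0,\dots,x_q\rangle$. The chain group $C_q(X)$ is the free abelian group generated by the $q$-simplices, with the identification $\langle x_0,\dots,x_q\rangle=(-1)^\rho\langle x_{\rho(0)},\dots,x_{\rho(q)}\rangle$ for permutations $\rho$, where $(-1)^\rho$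 is the sign of $\rho$. The boundary $\partial_q:C_q(X)\to C_{q-1}(X)$ is given by $\partial_q\langle x_0,\dots,x_q\rangle=\sum_{i=0}^q(-1)^i\langle x_0,\dots,\widehat{x_i},\dots,x_q\rangle$ (with $\partial_0=0$). Put $Z_q(X)=\ker\partial_q$, $B_q(X)=\operatorname{im}\partial_{q+1}$, $H_q(X)=Z_q(X)/B_q(X)$. A continuous $f:X\to Y$ induces $f_\#:C_q(X)\to C_q(Y)$, $f_\#\langle x_0,\dots,x_q\rangle=\langle f(x_0),\dots,f(x_q)\rangle$, interpreted as $0$ if the points $f(x_0),\dots,f(x_q)$ are not all distinct, and hence a homomorphism $f_*:H_q(X)\to H_q(Y)$. *)

(* Defs.v *)
From HB Require Import structures.
From mathcomp Require Import freeg.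
From mathcomp Require Import all_boot all_order all_algebra all_fingroup.
From mathcomp Require Import generic_quotient ring_quotient.
From mathcomp Require Import boolp classical_sets cardinality.
From mathcomp Require Import ring zify.

Set Implicit Arguments.
Unset Strict Implicit.
Unset Printing Implicit Defensive.

Import GRing.Theory.

Local Open Scope ring_scope.
Local Open Scope quotient_scope.

Record digital_image := DigitalImage {
  point :> Type;
  adj : point -> point -> Prop;
  adj_sym : forall x y, adj x y -> adj y x;
  adj_irr : forall x, ~ adj x x }.

Definition adjeq (X : digital_image) (x y : X) : Prop := adj x y \/ x = y.

Definition dcontinuous (X Y : digital_image) (f : X -> Y) : Prop :=
  forall x x' : X, adj x x' -> adjeq (f x) (f x').

Section Interval.
Variable k : nat.

Definition interval_adj (s t : 'I_k.+1) : Prop :=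
  `|(s : nat)%:Z - (t : nat)%:Z| = 1.

Lemma interval_adj_sym s t : interval_adj s t -> interval_adj t s.
Proof. by rewrite /interval_adj Num.Theory.distrC. Qed.

Lemma interval_adj_irr s : ~ interval_adj s s.
Proof. by rewrite /interval_adj subrr. Qed.

(* The digital interval [0,k]; its carrier 'I_k.+1 is {0, ..., k}. *)
Definition interval : digital_image :=
  DigitalImage interval_adj_sym interval_adj_irr.

End Interval.

Section NP2.
Variables X Y : digital_image.

Definition NP2_adj (p q : X * Y) : Prop :=
  [/\ p <> q, adjeq p.1 q.1 & adjeq p.2 q.2].

Lemma adjeq_sym (Z : digital_image) (x y : Z) : adjeq x y -> adjeq y x.
Proof. by case=> [/adj_sym|->]; [left|right]. Qed.

Lemma NP2_adj_sym p q : NP2_adj p q -> NP2_adj q p.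
Proof. by case=> pq /adjeq_sym h1 /adjeq_sym h2; split=> // /esym. Qed.

Lemma NP2_adj_irr p : ~ NP2_adj p p. Proof. by case. Qed.

Definition NP2 : digital_image := DigitalImage NP2_adj_sym NP2_adj_irr.

End NP2.

Definition strongly_homotopic (X Y : digital_image) (f g : X -> Y) : Prop :=
  exists2 k : nat, (0 < k)%N &
  exists H : NP2 X (interval k) -> Y,
    [/\ dcontinuous H,
        forall x : X, H (x, ord0) = f x
      & forall x : X, H (x, ord_max) = g x].

Section GeneratedSubgroup.
Variables (V : zmodType) (G : V -> Prop).

Definition gen_subgroup : {pred V} := fun v =>
  `[< forall S : zmodClosed V, (forall u, G u -> u \in S) -> v \in S >].

Lemma gen_subgroup_closed : zmod_closed gen_subgroup.
Proof.
split=> [|u v /asboolP hu /asboolP hv]; apply/asboolP => S hS.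
  exact: rpred0.
by apply: rpredB; [apply: hu|apply: hv].
Qed.

HB.instance Definition _ :=
  GRing.isZmodClosed.Build V gen_subgroup gen_subgroup_closed.

Lemma mem_gen_subgroup u : G u -> u \in gen_subgroup.
Proof. by move=> Gu; apply/asboolP => S; apply. Qed.

End GeneratedSubgroup.

Section PreimageSubgroup.
Variables (V W : zmodType) (phi : {additive V -> W}) (T : zmodClosed W).

Definition preim_subgroup : {pred V} := fun v => phi v \in T.

Lemma preim_subgroup_closed : zmod_closed preim_subgroup.
Proof.
split=> [|u v hu hv]; rewrite unfold_in ?raddf0 ?rpred0 // raddfB.
exact: rpredB.
Qed.

HB.instance Definition _ :=
  GRing.isZmodClosed.Build V preim_subgroup preim_subgroup_closed.

Lemma gen_subgroup_sub (G : V -> Prop) :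
  (forall u, G u -> phi u \in T) ->
  forall v, v \in gen_subgroup G -> phi v \in T.
Proof.
move=> h v /asboolP hv.
by have := hv preim_subgroup h; rewrite unfold_in.
Qed.

End PreimageSubgroup.

Lemma pi_quot_eq0 (V : zmodType) (S : zmodClosed V) (v : V) :
  (\pi_(Quotient.quot S) v == 0) = (v \in S).
Proof. by rewrite -[v in RHS]subr0 Quotient.idealrBE raddf0. Qed.

Section QuotientMap.
Variables (V W : zmodType) (S : zmodClosed V) (T : zmodClosed W).
Variables (phi : {additive V -> W}).

(* The hypothesis is not used in the body; carrying it as an argument is what
   lets the additive structure below be inferred. *)
Definition quot_map of (forall v, v \in S -> phi v \in T) :=
  fun x : Quotient.quot S => \pi_(Quotient.quot T) (phi (repr x)).

Variable h : forall v, v \in S -> phi v \in T.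

Lemma quot_mapE v :
  quot_map h (\pi_(Quotient.quot S) v) = \pi_(Quotient.quot T) (phi v).
Proof.
apply/eqP; rewrite -Quotient.idealrBE -raddfB h // Quotient.idealrBE.
by rewrite reprK.
Qed.

Lemma quot_map_zmod_morphism : zmod_morphism (quot_map h).
Proof.
move=> x y; rewrite -[x]reprK -[y]reprK -raddfB !quot_mapE -raddfB.
by rewrite raddfB.
Qed.

HB.instance Definition _ :=
  GRing.isZmodMorphism.Build (Quotient.quot S) (Quotient.quot T) (quot_map h)
    quot_map_zmod_morphism.

End QuotientMap.

Arguments quot_map {V W S T} phi h x.

Section FreeExtension.
Variables (K : choiceType).

Lemma freeg_additive_eq (V : zmodType)
    (phi psi : {additive {freeg K / int} -> V}) :
  (forall k, phi << k >> = psi << k >>) -> phi =1 psi.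
Proof.
move=> h c; rewrite -(freeg_sumE c) !raddf_sum; apply: eq_bigr => k _.
by rewrite -[coeff k c]intz -freegU_mulz !raddfMz h.
Qed.

Variables (L : choiceType) (f : K -> {freeg L / int}).

Definition freeg_ext (c : {freeg K / int}) : {freeg L / int} := fglift f c.

Lemma freeg_ext_zmod_morphism : zmod_morphism freeg_ext.
Proof. exact: lift_is_additive. Qed.

HB.instance Definition _ :=
  GRing.isZmodMorphism.Build {freeg K / int} {freeg L / int} freeg_ext
    freeg_ext_zmod_morphism.

Lemma freeg_extU k : freeg_ext << k >> = f k.
Proof. by rewrite /freeg_ext liftU scale1r. Qed.

End FreeExtension.

Section Simplices.
Variable X : digital_image.

Definition mutually_adjacent n (x : 'I_n -> X) : Prop :=
  forall i j, i != j -> adj (x i) (x j).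

(* A q-simplex together with an ordering x_0, ..., x_q of its points. *)
Record simplex (q : nat) := Simplex {
  vertex :> 'I_q.+1 -> X;
  vertexP : mutually_adjacent vertex }.

HB.instance Definition _ q := gen_eqMixin (simplex q).
HB.instance Definition _ q := gen_choiceMixin (simplex q).

Lemma simplex_inj q (x y : simplex q) : x =1 y -> x = y.
Proof.
case: x y => [x hx] [y hy] /= /funext exy; case: y / exy hy => hy.
by congr Simplex; exact: Prop_irrelevance.
Qed.

Lemma precomp_subproof p q (x : simplex q) (s : 'I_p.+1 -> 'I_q.+1) :
  injective s -> mutually_adjacent (x \o s).
Proof. by move=> s_inj i j ij; apply: vertexP; rewrite inj_eq. Qed.

Definition precomp p q (x : simplex q) (s : 'I_p.+1 -> 'I_q.+1)
  (s_inj : injective s) : simplex p := Simplex (precomp_subproof x s_inj).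

Definition face q (x : simplex q.+1) (i : 'I_q.+2) : simplex q :=
  precomp x (@lift_inj _ i).

Definition permute q (x : simplex q) (s : 'S_q.+1) : simplex q :=
  precomp x (@perm_inj _ s).

Definition orientation_relation q (c : {freeg (simplex q) / int}) : Prop :=
  exists (x : simplex q) (s : 'S_q.+1),
    c = << x >> - << (-1) ^+ s *g permute x s >>.

(* C_q: the free abelian group on ordered q-simplices, modulo the subgroup
   generated by the elements <x_0,...,x_q> - (-1)^s <x_s(0),...,x_s(q)>. *)
Definition chain q := Quotient.quot (gen_subgroup (@orientation_relation q)).

HB.instance Definition _ q := GRing.Zmodule.on (chain q).

Definition oriented q (x : simplex q) : chain q := \pi_(chain q) << x >>.

Lemma pi_freegU q k (x : simplex q) :
  \pi_(chain q) << k *g x >> = oriented x *~ k.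
Proof. by rewrite -[k in LHS]intz -freegU_mulz raddfMz. Qed.

Lemma oriented_permute q (x : simplex q) (s : 'S_q.+1) :
  oriented (permute x s) = oriented x *~ (-1) ^+ s.
Proof.
have /eqP : oriented x - oriented (permute x s) *~ (-1) ^+ s == 0.
  rewrite -pi_freegU -raddfB pi_quot_eq0; apply: mem_gen_subgroup.
  by exists x, s.
move/subr0_eq => ->.
by rewrite -mulrzA -signr_addb addbb mulr1z.
Qed.

End Simplices.

Lemma lift_permP n (s : 'S_n.+1) (i : 'I_n.+1) :
  exists t : 'S_n, s = lift_perm i (s i) t.
Proof.
pose u k := odflt k (unlift (s i) (s (lift i k))).
have uK k : lift (s i) (u k) = s (lift i k).
  rewrite /u; have := neq_lift i k.
  by rewrite -(can_eq (permK s)) => /unlift_some[? ? ->].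
have u_inj : injective u.
  by move=> k l /(congr1 (lift (s i))); rewrite !uK => /perm_inj/lift_inj.
exists (perm u_inj); apply/permP => k.
case: (unliftP i k) => [l|] ->; last by rewrite lift_perm_id.
by rewrite lift_perm_lift permE uK.
Qed.

Lemma signr_lift_perm n (i j : 'I_n.+1) (t : 'S_n) :
  (-1) ^+ lift_perm i j t = (-1) ^+ i * (-1) ^+ j * (-1) ^+ t :> int.
Proof.
by rewrite odd_lift_perm -addbA signr_addb signr_addb !signr_odd mulrA.
Qed.

Section Boundary.
Variable X : digital_image.

(* A chosen representative of the boundary, before passing to the quotient. *)
Definition simplex_boundary q (x : simplex X q.+1) :
    {freeg (simplex X q) / int} :=
  \sum_(i < q.+2) << (-1) ^+ i *g face x i >>.

Lemma pi_simplex_boundary q (x : simplex X q.+1) :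
  \pi_(chain X q) (simplex_boundary x) =
  \sum_(i < q.+2) oriented (face x i) *~ (-1) ^+ i.
Proof. by rewrite raddf_sum; apply: eq_bigr => i _; exact: pi_freegU. Qed.

Lemma face_permute q (x : simplex X q.+1) (s : 'S_q.+2) i t :
  s = lift_perm i (s i) t ->
  face (permute x s) i = permute (face x (s i)) t.
Proof.
by move=> st; apply: simplex_inj => k /=; rewrite st lift_perm_lift -st.
Qed.

Lemma simplex_boundary_permute q (x : simplex X q.+1) (s : 'S_q.+2) :
  \pi_(chain X q) (simplex_boundary (permute x s)) =
  \pi_(chain X q) (simplex_boundary x) *~ (-1) ^+ s.
Proof.
rewrite !pi_simplex_boundary [in RHS](reindex_inj (@perm_inj _ s)) /=.
rewrite mulrz_suml.
apply: eq_bigr => i _; have [t st] := lift_permP s i.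
rewrite (face_permute x st) oriented_permute -!mulrzA; congr (_ *~ _).
have es : (-1) ^+ s = (-1) ^+ i * (-1) ^+ s i * (-1) ^+ t :> int.
  by rewrite {1}st signr_lift_perm.
have := sqrr_sign int (s i); rewrite es.
move: ((-1) ^+ s i) ((-1) ^+ i) ((-1) ^+ t) => a b c a2.
by rewrite -[LHS](mulr1) -[in LHS]a2; ring.
Qed.

Lemma boundary_subproof q c :
  c \in gen_subgroup (@orientation_relation X q.+1) ->
  freeg_ext (@simplex_boundary q) c \in
    gen_subgroup (@orientation_relation X q).
Proof.
apply: gen_subgroup_sub => {}c [x [s ->]].
rewrite -pi_quot_eq0 -[(-1) ^+ s]intz -freegU_mulz !raddfB !raddfMz /=.
rewrite !freeg_extU; apply/eqP.
suff e : \pi_(chain X q) (simplex_boundary x) +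
    (- \pi_(chain X q) (simplex_boundary (permute x s))) *~ (-1) ^+ s = 0.
  exact: e.
rewrite simplex_boundary_permute mulNrz -mulrzA -signr_addb addbb mulr1z.
exact: subrr.
Qed.

(* In degree 0 the target is chain X 0.-1 = chain X 0 and the map is zero, so
   that every 0-chain is a cycle. *)
Definition boundary q : {additive chain X q -> chain X q.-1} :=
  match q with
  | 0 => \0
  | q'.+1 => quot_map (freeg_ext (@simplex_boundary q')) (@boundary_subproof q')
  end.

Lemma boundary_oriented q (x : simplex X q.+1) :
  boundary q.+1 (oriented x) = \sum_(i < q.+2) oriented (face x i) *~ (-1) ^+ i.
Proof.
by rewrite /oriented /= quot_mapE /= freeg_extU pi_simplex_boundary.
Qed.

Lemma chain_additive_eq q (V : zmodType) (phi psi : {additive chain X q -> V}) :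
  (forall x, phi (oriented x) = psi (oriented x)) -> phi =1 psi.
Proof.
move=> h c; rewrite -[c]reprK.
exact: (@freeg_additive_eq _ _ (phi \o \pi) (psi \o \pi)).
Qed.

Lemma boundaryK q (c : chain X q.+2) : boundary q.+1 (boundary q.+2 c) = 0.
Proof.
apply: (@chain_additive_eq _ _ (boundary q.+1 \o boundary q.+2) \0) => x.
change (boundary q.+1 (boundary q.+2 (oriented x)) = 0).
rewrite boundary_oriented raddf_sum.
under eq_bigr => i _ do
  rewrite raddfMz boundary_oriented mulrz_suml.
rewrite pair_bigA /= (bigID (fun p : 'I_q.+3 * 'I_q.+2 => p.2 < p.1)%N) /=.
rewrite [X in _ + X](reindex_onto
  (fun p : 'I_q.+3 * 'I_q.+2 => (inord p.2, inord p.1.-1))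
  (fun p : 'I_q.+3 * 'I_q.+2 => (inord p.2.+1, inord p.1))) /=; last first.
  move=> [i j] /=; rewrite -leqNgt => ij.
  have i2 : (i < q.+2)%N by apply: leq_ltn_trans ij _.
  have j3 : (j.+1 < q.+3)%N by rewrite ltnS.
  by congr pair; apply: val_inj; rewrite /= !inordK //= ?inordK // ltnW.
rewrite [X in _ + X](eq_bigl
  (fun p : 'I_q.+3 * 'I_q.+2 => p.2 < p.1)%N) => [|[i j] /=]; last first.
  apply/andP/idP => [[ij /eqP[/(congr1 val) /= + /(congr1 val) /=]]|ij].
    have i2 : (i.-1 < q.+2)%N by have := ltn_ord i; case: (nat_of_ord i).
    have j3 : (j < q.+3)%N by apply: ltnW; rewrite ltnS.
    have j2 := ltn_ord j.
    by move: ij; rewrite !inordK ?inordK // => ij <- _; lia.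
  have i0 : (0 < i)%N by apply: leq_ltn_trans ij.
  have i2 : (i.-1 < q.+2)%N by have := ltn_ord i; lia.
  have j3 : (j < q.+3)%N by apply: ltnW; rewrite ltnS.
  split; first by rewrite !inordK // -leqNgt -ltnS prednK.
  apply/eqP; congr pair; apply: val_inj; rewrite /= (inordK i2, inordK j3).
    by rewrite prednK // inordK.
  by rewrite inordK.
rewrite -big_split big1 //= => -[i j] /= ij.
have i0 : (0 < i)%N by apply: leq_ltn_trans ij.
have i2 : (i.-1 < q.+2)%N by have := ltn_ord i; lia.
have j3 : (j < q.+3)%N by apply: ltnW; rewrite ltnS.
have -> : face (face x (inord j)) (inord i.-1) = face (face x i) j.
  apply: simplex_inj => k /=; congr (x _); apply: val_inj => /=.
  by rewrite !inordK // /bump; lia.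
rewrite !inordK // -!mulrzA -mulrzDr.
have -> : (-1) ^+ i = (-1) * (-1) ^+ i.-1 :> int by rewrite -exprS prednK.
by rewrite mulN1r mulrN [X in _ + X]mulrC addNr.
Qed.

Definition cycle_subgroup q : {pred chain X q} := fun c => boundary q c == 0.

Lemma cycle_subgroup_closed q : zmod_closed (@cycle_subgroup q).
Proof.
split=> [|c d /eqP hc /eqP hd]; rewrite unfold_in ?raddf0 //.
by rewrite raddfB hc hd subrr.
Qed.

HB.instance Definition _ q :=
  GRing.isZmodClosed.Build (chain X q) (@cycle_subgroup q)
    (cycle_subgroup_closed q).

(* Z_q, as a subgroup of C_q. *)
Record cycle q := Cycle {
  cycle_chain : chain X q;
  cycleP : cycle_chain \in @cycle_subgroup q }.

HB.instance Definition _ q := [isSub for @cycle_chain q].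
HB.instance Definition _ q := [Choice of cycle q by <:].
HB.instance Definition _ q := [SubChoice_isSubZmodule of cycle q by <:].

(* B_q, viewed inside Z_q; boundaryK shows that no boundary is lost. *)
Definition boundary_subgroup q : {pred cycle q} := fun z =>
  `[< exists c : chain X q.+1, boundary q.+1 c = cycle_chain z >].

Lemma boundary_subgroup_closed q : zmod_closed (@boundary_subgroup q).
Proof.
split=> [|z w /asboolP[c hc] /asboolP[d hd]]; apply/asboolP.
  by exists 0; rewrite !raddf0.
by exists (c - d); rewrite [LHS]raddfB hc hd.
Qed.

HB.instance Definition _ q :=
  GRing.isZmodClosed.Build (cycle q) (@boundary_subgroup q)
    (boundary_subgroup_closed q).

Definition homology q := Quotient.quot (@boundary_subgroup q).

HB.instance Definition _ q := GRing.Zmodule.on (homology q).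

End Boundary.

Arguments boundary {X} q.

Section OrientedTuple.
Variable X : digital_image.

Lemma mutually_adjacent_inj n (x : 'I_n -> X) :
  mutually_adjacent x -> injective x.
Proof.
move=> hx i j xij; apply/eqP/negPn/negP => /hx.
by rewrite xij => /adj_irr.
Qed.

(* The class <y_0,...,y_q> of an arbitrary tuple, 0 if it is not a simplex. *)
Definition oriented_tuple q (y : 'I_q.+1 -> X) : chain X q :=
  if pselect (mutually_adjacent y) is left h then oriented (Simplex h) else 0.

Lemma oriented_tupleE q (x : simplex X q) : oriented_tuple x = oriented x.
Proof.
rewrite /oriented_tuple; case: pselect => [h|nh]; last by case: nh; exact: vertexP.
by congr oriented; apply: simplex_inj.
Qed.

Lemma oriented_tuple0 q (y : 'I_q.+1 -> X) :
  ~ injective y -> oriented_tuple y = 0.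
Proof.
rewrite /oriented_tuple; case: pselect => // h [];
  exact: mutually_adjacent_inj.
Qed.

Lemma oriented_tuple_permute q (y : 'I_q.+1 -> X) (s : 'S_q.+1) :
  oriented_tuple (y \o s) = oriented_tuple y *~ (-1) ^+ s.
Proof.
have [hy|hy] := pselect (mutually_adjacent y).
  rewrite -[y]/(vertex (Simplex hy)) oriented_tupleE -oriented_permute.
  exact: (oriented_tupleE (permute (Simplex hy) s)).
rewrite {2}/oriented_tuple; case: pselect => // _; rewrite mul0rz.
rewrite /oriented_tuple; case: pselect => // h; case: hy => i j ij.
have := h (s^-1 i)%g (s^-1 j)%g; rewrite /= !permKV; apply.
by rewrite (inj_eq perm_inj).
Qed.

Lemma degenerate_faces q (y : 'I_q.+2 -> X) : ~ injective y ->
  \sum_(i < q.+2) oriented_tuple (y \o lift i) *~ (-1) ^+ i = 0.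
Proof.
move=> y_ninj.
have [a [b [ab yab]]] : exists a b, a != b /\ y a = y b.
  apply: contrapT => hn; apply: y_ninj => a b yab.
  by apply/eqP/negPn/negP => ab; apply: hn; exists a, b.
rewrite (bigD1 a) //= (bigD1 b) 1?eq_sym //= [X in _ + (_ + X)]big1 => [|i].
  rewrite addr0.
  have [t st] := lift_permP (tperm a b) a.
  rewrite tpermL in st.
  have -> : y \o lift a = (y \o lift b) \o t.
    apply: funext => k /=; rewrite -(lift_perm_lift a b t) -st.
    by case: tpermP => // ->.
  rewrite oriented_tuple_permute -mulrzA -mulrzDr.
  have := signr_lift_perm a b t; rewrite -st odd_tperm ab expr1.
  have a2 := sqrr_sign int a; have b2 := sqrr_sign int b.
  have t2 : ((-1) ^+ t) ^+ 2 = 1 :> int by rewrite sqrr_sign.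
  move: ((-1) ^+ a) ((-1) ^+ b) ((-1) ^+ t) a2 b2 t2 => u v w u2 v2 w2 e.
  have -> : w * u + v = 0; last by rewrite mulr0z.
  have -> : w * u = v ^+ 2 * (w * u) by rewrite v2 mul1r.
  have -> : v ^+ 2 * (w * u) = v * (u * v * w) by ring.
  by rewrite -e mulrN1 addNr.
case/andP=> ia ib; rewrite oriented_tuple0 ?mul0rz // => inj.
have [a' ea _] := unlift_some ia; have [b' eb _] := unlift_some ib.
have eab : a' = b' by apply: inj; rewrite /= -ea -eb.
by move: ab; rewrite ea eb eab eqxx.
Qed.

End OrientedTuple.

Section InducedMap.
Variables (X Y : digital_image) (f : X -> Y).

Lemma push_subproof n (x : 'I_n -> X) : dcontinuous f ->
  mutually_adjacent x -> injective (f \o x) -> mutually_adjacent (f \o x).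
Proof.
move=> hf hx inj i j ij; case: (hf _ _ (hx i j ij)) => // /inj eij.
by rewrite eij eqxx in ij.
Qed.

Hypothesis hf : dcontinuous f.

Definition simplex_push q (x : simplex X q) : {freeg (simplex Y q) / int} :=
  if pselect (injective (f \o x)) is left inj
  then << Simplex (push_subproof hf (vertexP x) inj) >> else 0.

Lemma pi_simplex_push q (x : simplex X q) :
  \pi_(chain Y q) (simplex_push x) = oriented_tuple (f \o x).
Proof.
rewrite /simplex_push; case: pselect => [inj|ninj].
  by rewrite -[f \o x]/(vertex (Simplex (push_subproof hf (vertexP x) inj)))
    oriented_tupleE.
by rewrite oriented_tuple0 // raddf0.
Qed.

Lemma chain_map_subproof q c :
  c \in gen_subgroup (@orientation_relation X q) ->
  freeg_ext (@simplex_push q) c \in gen_subgroup (@orientation_relation Y q).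
Proof.
apply: gen_subgroup_sub => {}c [x [s ->]].
rewrite -pi_quot_eq0 -[(-1) ^+ s]intz -freegU_mulz !raddfB !raddfMz /=.
rewrite !freeg_extU; apply/eqP.
suff e : \pi_(chain Y q) (simplex_push x) +
    (- \pi_(chain Y q) (simplex_push (permute x s))) *~ (-1) ^+ s = 0.
  exact: e.
rewrite !pi_simplex_push -[_ \o permute x s]/((f \o x) \o s).
rewrite oriented_tuple_permute mulNrz -mulrzA -signr_addb addbb mulr1z.
exact: subrr.
Qed.

Definition chain_map q : {additive chain X q -> chain Y q} :=
  quot_map (freeg_ext (@simplex_push q)) (@chain_map_subproof q).

Lemma chain_map_oriented q (x : simplex X q) :
  chain_map q (oriented x) = oriented_tuple (f \o x).
Proof. by rewrite /oriented /= quot_mapE /= freeg_extU pi_simplex_push. Qed.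

Lemma boundary_oriented_tuple q (x : simplex X q.+1) :
  boundary q.+1 (oriented_tuple (f \o x)) =
  \sum_(i < q.+2) oriented_tuple ((f \o x) \o lift i) *~ (-1) ^+ i.
Proof.
have [inj|ninj] := pselect (injective (f \o x)); last first.
  by rewrite degenerate_faces // oriented_tuple0 // raddf0.
have hfx := push_subproof hf (vertexP x) inj.
rewrite -[f \o x]/(vertex (Simplex hfx)) oriented_tupleE boundary_oriented.
apply: eq_bigr => i _; congr (_ *~ _).
by rewrite -(oriented_tupleE (face (Simplex hfx) i)).
Qed.

Lemma boundary_chain_map q (c : chain X q) :
  boundary q (chain_map q c) = chain_map q.-1 (boundary q c).
Proof.
case: q c => [|q] c; first by rewrite [boundary 0]/= !raddf0.
apply: (@chain_additive_eq _ _ _ (boundary q.+1 \o chain_map q.+1)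
  (chain_map q \o boundary q.+1)) => x.
change (boundary q.+1 (chain_map q.+1 (oriented x)) =
  chain_map q (boundary q.+1 (oriented x))).
rewrite chain_map_oriented boundary_oriented_tuple boundary_oriented raddf_sum.
by apply: eq_bigr => i _; rewrite raddfMz chain_map_oriented.
Qed.

Lemma cycle_map_subproof q (z : cycle X q) :
  chain_map q (cycle_chain z) \in @cycle_subgroup Y q.
Proof.
by rewrite unfold_in boundary_chain_map (eqP (cycleP z)) raddf0.
Qed.

Definition cycle_map q (z : cycle X q) : cycle Y q :=
  Cycle (cycle_map_subproof z).

Lemma cycle_map_zmod_morphism q : zmod_morphism (@cycle_map q).
Proof. by move=> z w; apply: val_inj; rewrite /= !raddfB. Qed.

HB.instance Definition _ q :=
  GRing.isZmodMorphism.Build (cycle X q) (cycle Y q) (@cycle_map q)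
    (@cycle_map_zmod_morphism q).

Lemma homology_map_subproof q (z : cycle X q) :
  z \in @boundary_subgroup X q -> cycle_map z \in @boundary_subgroup Y q.
Proof.
move=> /asboolP[c hc]; apply/asboolP; exists (chain_map q.+1 c).
by rewrite boundary_chain_map /= -hc.
Qed.

Definition homology_map q : {additive homology X q -> homology Y q} :=
  quot_map (@cycle_map q) (@homology_map_subproof q).

End InducedMap.

(* Main.v *)
(** A strong homotopy is a sequence of maps in which consecutive members are
    "close": they send adjacent-or-equal points to adjacent-or-equal points.
    Since X is finite, each step from one map to a close one can be refined so
    that only the value at one point [a] changes at a time.  For two close maps
    f, g that differ only at [a], the operator sending a simplex x to
    <f a, g x_0, ..., g x_q> if [a] is a vertex of x, and to 0 otherwise, is a
    chain homotopy.  Unlike the usual prism operator it involves no ordering of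
    the vertices, so it is compatible with the orientation relations. *)

Require Import Defs.
From mathcomp Require Import freeg.
From mathcomp Require Import all_boot all_order all_algebra perm.
From mathcomp Require Import generic_quotient ring_quotient.
From mathcomp Require Import boolp classical_sets cardinality.

Set Implicit Arguments.
Unset Strict Implicit.
Unset Printing Implicit Defensive.

Import GRing.Theory.

Local Open Scope ring_scope.
Local Open Scope quotient_scope.

(** * Extending functions on ordered simplices to chain groups *)

Section ChainLift.
Variables (X Y : digital_image) (q p : nat) (phi : simplex X q -> chain Y p).
Hypothesis phi_permute :
  forall x s, phi (permute x s) = phi x *~ (-1) ^+ s.

Lemma chain_lift_subproof c :
  c \in gen_subgroup (@orientation_relation X q) ->
  freeg_ext (fun x => repr (phi x)) c \in
    gen_subgroup (@orientation_relation Y p).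
Proof.
apply: gen_subgroup_sub => {}c [x [s ->]].
rewrite -pi_quot_eq0 -[(-1) ^+ s]intz -freegU_mulz !raddfB !raddfMz /=.
rewrite !freeg_extU; apply/eqP.
suff e : \pi_(chain Y p) (repr (phi x)) +
    (- \pi_(chain Y p) (repr (phi (permute x s)))) *~ (-1) ^+ s = 0.
  exact: e.
rewrite !reprK phi_permute mulNrz -mulrzA -signr_addb addbb mulr1z.
exact: subrr.
Qed.

(** Since [freeg_ext] takes values in a free group, an arbitrary representative of each [phi x] is
    chosen; passing to the quotient removes the choice. *)
Definition chain_lift : {additive chain X q -> chain Y p} :=
  quot_map (freeg_ext (fun x => repr (phi x))) chain_lift_subproof.

Lemma chain_lift_oriented x : chain_lift (oriented x) = phi x.
Proof. by rewrite /oriented /= quot_mapE /= freeg_extU reprK. Qed.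

End ChainLift.

(** * Tuples with a point prepended *)

Definition fcons T n (a : T) (y : 'I_n -> T) (i : 'I_n.+1) : T :=
  oapp y a (unlift ord0 i).

Section Fcons.
Variables (T : Type) (n : nat).
Implicit Types (a : T) (y : 'I_n -> T).

Lemma fcons_lift0 a y : fcons a y \o lift ord0 = y.
Proof. by apply: funext => j; rewrite /fcons /= liftK. Qed.

Lemma fcons_lift a (y : 'I_n.+1 -> T) (j : 'I_n.+1) :
  fcons a y \o lift (lift ord0 j) = fcons a (y \o lift j).
Proof.
apply: funext => k; rewrite /fcons /=.
case: (unliftP ord0 k) => [l|] -> /=.
  suff -> : lift (lift ord0 j) (lift ord0 l) = lift ord0 (lift j l).
    by rewrite liftK.
  by apply: val_inj; rewrite /= /bump /= !add1n ltnS addnS.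
suff -> : lift (lift ord0 j) ord0 = ord0 by rewrite unlift_none.
exact: val_inj.
Qed.

Lemma fcons_permute a y (s : 'S_n) :
  fcons a (y \o s) = fcons a y \o lift_perm ord0 ord0 s.
Proof.
apply: funext => k; rewrite /fcons /=.
case: (unliftP ord0 k) => [l|] -> /=; first by rewrite lift_perm_lift liftK.
by rewrite lift_perm_id unlift_none.
Qed.

Lemma fcons_faceE (x : 'I_n.+1 -> T) (i : 'I_n.+1) :
  fcons (x i) (x \o lift i) = x \o lift_perm ord0 i 1%g.
Proof.
apply: funext => k; rewrite /fcons /=.
case: (unliftP ord0 k) => [l|] -> /=; first by rewrite lift_perm_lift perm1.
by rewrite lift_perm_id.
Qed.

End Fcons.

(** * The boundary of a cone *)

Section Boundary.
Variable Y : digital_image.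

(** A tuple with a repetition is 0, and so is its alternating face sum by [degenerate_faces]; an
    injective one is a genuine simplex. *)
Lemma boundary_oriented_tuple_adjeq q (y : 'I_q.+2 -> Y) :
  (forall i j, adjeq (y i) (y j)) ->
  boundary q.+1 (oriented_tuple y) =
  \sum_(i < q.+2) oriented_tuple (y \o lift i) *~ (-1) ^+ i.
Proof.
move=> y_adj; have [inj|ninj] := pselect (injective y); last first.
  by rewrite degenerate_faces // oriented_tuple0 // raddf0.
have hy : mutually_adjacent y.
  by move=> i j ij; case: (y_adj i j) => // /inj eij; rewrite eij eqxx in ij.
rewrite -[y]/(vertex (Simplex hy)) oriented_tupleE boundary_oriented.
by apply: eq_bigr => i _; rewrite -(oriented_tupleE (face (Simplex hy) i)).
Qed.

Lemma boundary_fcons q (a : Y) (y : 'I_q.+1 -> Y) :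
  (forall i j, adjeq (y i) (y j)) -> (forall i, adjeq a (y i)) ->
  boundary q.+1 (oriented_tuple (fcons a y)) =
  oriented_tuple y -
  \sum_(j < q.+1) oriented_tuple (fcons a (y \o lift j)) *~ (-1) ^+ j.
Proof.
move=> yy ay; rewrite boundary_oriented_tuple_adjeq => [|i j]; last first.
  rewrite /fcons; case: (unlift ord0 i) => [i'|] /=;
  case: (unlift ord0 j) => [j'|] //=; first exact: adjeq_sym.
  by right.
rewrite big_ord_recl fcons_lift0 expr0 mulr1z -sumrN; congr (_ + _).
apply: eq_bigr => j _; rewrite fcons_lift -mulrNz; congr (_ *~ _).
by rewrite /= /bump add1n exprS mulN1r.
Qed.

(** Moving [x i] to the front is a cyclic permutation of sign [(-1) ^+ i], which cancels the
    factor. *)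
Lemma oriented_tuple_fcons_face q (x : 'I_q.+1 -> Y) (i : 'I_q.+1) :
  oriented_tuple (fcons (x i) (x \o lift i)) *~ (-1) ^+ i = oriented_tuple x.
Proof.
rewrite fcons_faceE oriented_tuple_permute -mulrzA signr_lift_perm.
by rewrite odd_perm1 !expr0 mul1r mulr1 -expr2 sqrr_sign mulr1z.
Qed.

End Boundary.

(** * Close maps *)

Section Close.
Variables X Y : digital_image.
Implicit Types f g : X -> Y.

(** For continuous [f] and [g], this is strong homotopy in a single step. *)
Definition close f g : Prop :=
  forall x x', adjeq x x' -> adjeq (f x) (g x').

Lemma dcontinuous_adjeq f (hf : dcontinuous f) : close f f.
Proof. by move=> x x' [/hf //|->]; right. Qed.

End Close.

(** * The chain homotopy for a change at one point *)

Section PointChange.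
Variables (X Y : digital_image) (f g : X -> Y) (a : X).
Hypotheses (hf : dcontinuous f) (hg : dcontinuous g) (fg : close f g).
Hypothesis fg_eq : forall v, v <> a -> f v = g v.

Definition cone_simplex q (x : simplex X q) : chain Y q.+1 :=
  if `[< exists i, x i = a >] then oriented_tuple (fcons (f a) (g \o x)) else 0.

(** Containing [a] does not depend on the ordering, and a permutation extended by the fixed apex
    keeps its sign. *)
Lemma cone_simplex_permute q (x : simplex X q) s :
  cone_simplex (permute x s) = cone_simplex x *~ (-1) ^+ s.
Proof.
rewrite /cone_simplex.
have -> : `[< exists i, permute x s i = a >] = `[< exists i, x i = a >].
  apply: asbool_equiv_eq; split=> [] [i hi]; first by exists (s i).
  by exists (s^-1 i)%g; rewrite /= permKV.
case: asboolP => _; last by rewrite mul0rz.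
rewrite -[g \o permute x s]/((g \o x) \o s) fcons_permute.
by rewrite oriented_tuple_permute odd_lift_perm.
Qed.

Definition cone_map q : {additive chain X q -> chain Y q.+1} :=
  chain_lift (@cone_simplex_permute q).

Lemma cone_simplex_in q (x : simplex X q) i : x i = a ->
  cone_simplex x = oriented_tuple (fcons (f a) (g \o x)).
Proof. by move=> xi; rewrite /cone_simplex asboolT //; exists i. Qed.

Lemma cone_simplex_notin q (x : simplex X q) :
  ~ (exists i, x i = a) -> cone_simplex x = 0.
Proof. by move=> h; rewrite /cone_simplex asboolF. Qed.

Lemma vertex_adjeq q (x : simplex X q) i j : adjeq (x i) (x j).
Proof. by have [->|/vertexP] := eqVneq i j; [right|left]. Qed.

(** The face opposite the apex is [g \o x]. The face omitting [g a] has only vertices where [f] and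
    [g] agree, besides the apex [f a], so it is [f \o x] up to sign. *)
Lemma boundary_cone_simplex q (x : simplex X q) i : x i = a ->
  boundary q.+1 (cone_simplex x) =
  oriented_tuple (g \o x) - oriented_tuple (f \o x) -
  \sum_(j < q.+1 | j != i)
    oriented_tuple (fcons (f a) (g \o x \o lift j)) *~ (-1) ^+ j.
Proof.
move=> xi; rewrite (cone_simplex_in xi) boundary_fcons; last 2 first.
- by move=> j k; apply: (dcontinuous_adjeq hg); exact: vertex_adjeq.
- by move=> j; apply: fg; rewrite -xi; exact: vertex_adjeq.
rewrite (bigD1 i) //= opprD addrA; congr (_ - _ - _).
rewrite -[RHS](oriented_tuple_fcons_face _ i) /= xi.
congr (oriented_tuple (fcons _ _) *~ _).
(* The vertices of a simplex are distinct, so those other than [x i] differ from [a]. *)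
apply: funext => k /=; rewrite fg_eq // -xi => /(mutually_adjacent_inj _) e.
by have := neq_lift i k; rewrite e ?eqxx //; exact: vertexP.
Qed.

Lemma push_notin q (x : simplex X q) :
  ~ (exists i, x i = a) -> g \o x = f \o x.
Proof.
by move=> h; apply: funext => k /=; rewrite fg_eq // => e; apply: h; exists k.
Qed.

(** Degree 0 is separate: there is no term [cone_map (boundary c)] from degree -1. *)
Lemma cone_map_homotopy0 (c : chain X 0) :
  boundary 1 (cone_map 0 c) = chain_map hg 0 c - chain_map hf 0 c.
Proof.
apply: (@chain_additive_eq _ _ _ (boundary 1 \o cone_map 0)
  (chain_map hg 0 \- chain_map hf 0)) => x.
change (boundary 1 (cone_map 0 (oriented x)) =
  chain_map hg 0 (oriented x) - chain_map hf 0 (oriented x)).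
rewrite chain_lift_oriented !chain_map_oriented.
have [[i xi]|nx] := pselect (exists i, x i = a).
  rewrite (boundary_cone_simplex xi) big1 ?subr0 // => j.
  by rewrite (ord1 i) (ord1 j).
by rewrite cone_simplex_notin // raddf0 push_notin // subrr.
Qed.

(** If [a] is a vertex of [x], the cones over the faces containing [a] cancel the sum left in
    [boundary_cone_simplex]. Otherwise all cones vanish and [f], [g] agree on [x]. *)
Lemma cone_map_homotopy q (c : chain X q.+1) :
  boundary q.+2 (cone_map q.+1 c) + cone_map q (boundary q.+1 c) =
  chain_map hg q.+1 c - chain_map hf q.+1 c.
Proof.
apply: (@chain_additive_eq _ _ _
  ((boundary q.+2 \o cone_map q.+1) \+ (cone_map q \o boundary q.+1))
  (chain_map hg q.+1 \- chain_map hf q.+1)) => x.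
change (boundary q.+2 (cone_map q.+1 (oriented x)) +
  cone_map q (boundary q.+1 (oriented x)) =
  chain_map hg q.+1 (oriented x) - chain_map hf q.+1 (oriented x)).
rewrite chain_lift_oriented !chain_map_oriented boundary_oriented raddf_sum.
under eq_bigr => j _ do rewrite raddfMz chain_lift_oriented.
have [[i xi]|nx] := pselect (exists i, x i = a); last first.
  rewrite cone_simplex_notin // raddf0 push_notin // subrr add0r.
  rewrite big1 // => j _; rewrite cone_simplex_notin ?mul0rz // => -[k e].
  by apply: nx; exists (lift j k).
rewrite (boundary_cone_simplex xi) [X in _ + X](bigD1 i) //=.
(* The face omitting [a] has zero cone, which matches the index excluded from the sum. *)
rewrite (@cone_simplex_notin _ (face x i)) ?mul0rz ?add0r => [|[k /=]];
  last first.
  rewrite -xi => /(mutually_adjacent_inj _) e.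
  by have := neq_lift i k; rewrite e ?eqxx //; exact: vertexP.
rewrite [X in _ + X](_ : _ = \sum_(j < q.+2 | j != i)
    oriented_tuple (fcons (f a) (g \o x \o lift j)) *~ (-1) ^+ j) ?subrK //.
apply: eq_bigr => j ji; have [k e _] := unlift_some ji.
by rewrite (@cone_simplex_in _ (face x j) k) //= -e.
Qed.

Lemma cycle_map_homologous q (z : Defs.cycle X q) :
  exists c, boundary q.+1 c =
    chain_map hg q (cycle_chain z) - chain_map hf q (cycle_chain z).
Proof.
exists (cone_map q (cycle_chain z)).
case: q z => [|q] z; first exact: cone_map_homotopy0.
by rewrite -cone_map_homotopy (eqP (Defs.cycleP z)) raddf0 addr0.
Qed.

Lemma homology_map_point_change q : homology_map hf q =1 homology_map hg q.
Proof.
move=> u; rewrite -[u]reprK /= !quot_mapE; apply/esym/eqP.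
rewrite -Quotient.idealrBE; apply/asboolP.
by have [c hc] := cycle_map_homologous (repr u); exists c; rewrite hc.
Qed.

End PointChange.

(** * From one-point changes to strong homotopies *)

Lemma eq_homology_map (X Y : digital_image) (f g : X -> Y)
    (hf : dcontinuous f) (hg : dcontinuous g) q :
  f =1 g -> homology_map hf q =1 homology_map hg q.
Proof.
by move=> /funext e; case: _ / e in hg *; rewrite (Prop_irrelevance hf hg).
Qed.

(** Induction on a list of the points where [f] may still differ from the fixed map [g];
    [{classic X}] supplies decidable equality. *)
Lemma homology_map_close_seq (X Y : digital_image) (s : seq {classic X})
    (f g : X -> Y) (hf : dcontinuous f) (hg : dcontinuous g) q :
  close f g -> (forall v : {classic X}, v \notin s -> f v = g v) ->
  homology_map hf q =1 homology_map hg q.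
Proof.
elim: s f hf => [|a s IHs] f hf fg fgE.
  by apply: eq_homology_map => v; exact: fgE.
pose f' (v : {classic X}) := if v == a then g v else f v.
have gf : close g f by move=> x x' /adjeq_sym /fg /adjeq_sym.
have ff := dcontinuous_adjeq hf; have gg := dcontinuous_adjeq hg.
(* Each pair of values of [f'] comes from [f], from [g], or from both, whence the four closeness
   facts [ff], [gg], [fg], [gf]. *)
have hf' : @dcontinuous X Y f'.
  move=> x x' /(@or_introl _ (x = x')) xx'.
  by rewrite /f'; do 2 case: ifP => _; auto.
have ff' : @close X Y f f' by move=> x x' xx'; rewrite /f'; case: ifP; auto.
have f'g : @close X Y f' g by move=> x x' xx'; rewrite /f'; case: ifP; auto.
have f'E (v : {classic X}) : v \notin s -> f' v = g v.
  rewrite /f' => vs; case: eqVneq => // va.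
  by apply: fgE; rewrite inE negb_or va.
move=> u; rewrite -(IHs f' hf' f'g f'E u).
apply: (@homology_map_point_change X Y f f' a) => // v va.
by rewrite /f'; case: eqVneq.
Qed.

Lemma homology_map_close (X Y : digital_image) (f g : X -> Y)
    (hf : dcontinuous f) (hg : dcontinuous g) q :
  finite_set [set: X]%classic -> close f g ->
  homology_map hf q =1 homology_map hg q.
Proof.
move=> finX fg.
have /finite_seqP[s sE] : finite_set [set: {classic X}]%classic := finX.
apply: (@homology_map_close_seq X Y s) => // v.
have : [set: {classic X}]%classic v by [].
by rewrite sE /= => ->.
Qed.

Theorem theorem4p3 (X Y : digital_image) (finX : finite_set [set: X]%classic)
    (f g : X -> Y) (hf : dcontinuous f) (hg : dcontinuous g)
    (hfg : strongly_homotopic f g) (q : nat) :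
  homology_map hf q =1 homology_map hg q.
Proof.
have [k _ [H [hH H0 H1]]] := hfg.
have H_adj (x x' : X) (t t' : Defs.interval k) :
    adjeq x x' -> adjeq t t' -> adjeq (H (x, t)) (H (x', t')).
  (* [NP2] adjacency relates only distinct points, so equality is treated apart. *)
  move=> xx' tt'; have [->|ne] := pselect ((x, t) = (x', t')); first by right.
  exact: hH.
(* The time slices of [H]; [inord n] has value [n] only for [n <= k], hence the bound in [step]. *)
pose F n (x : X) := H (x, inord n : Defs.interval k).
have hF n : dcontinuous (F n).
  by move=> x x' xx'; apply: H_adj; [left|right].
suff step n : (n <= k)%N -> homology_map hf q =1 homology_map (hF n) q.
  move=> u; rewrite (step k) //; apply: eq_homology_map => x.
  rewrite -H1 /F; congr (H (_, _)).
  by apply: val_inj; rewrite /= inordK.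
elim: n => [_|n IHn nk] u.
  apply: eq_homology_map => x; rewrite -H0 /F; congr (H (_, _)).
  by apply: val_inj; rewrite /= inordK.
(* Consecutive slices are close because the times [n] and [n.+1] are adjacent. *)
rewrite (IHn (ltnW nk)); apply: homology_map_close => // x x' xx'.
apply: H_adj => //; left.
rewrite /= /interval_adj !inordK // 1?ltnW //.
by rewrite Num.Theory.distrC -natz -[n%:Z]natz -natrB // subSnn.
Qed.
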